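(* There exist an analytic function $f$ on $\mathbb D$ which belongs to $S_{-\nu}$ for all $\nu>0$, and a sequence of positive radii $r_k<1$ increasing to $1$, such that $$\lim_{k\to\infty}\min\{|f(z)|:|z|=r_k\}=\infty.$$
   Context: $\mathbb D$ is the open unit disc in $\mathbb C$. For $\mu\in\mathbb R$, $S_\mu$ is the Hilbert space of analytic functions $f(z)=\sum_{n=0}^\infty a_nz^n$ on $\mathbb D$ with $\|f\|_{S_\mu}=\big(\sum_{n=0}^\infty|a_n|^2(n+1)^{2\mu}\big)^{1/2}<\infty$. *)

(* Defs.v *)
From Stdlib Require Import Reals.
From Coquelicot Require Import Coquelicot.

Open Scope R_scope.

(** Functions on the unit disc [D = {z | Cmod z < 1}] are represented by total
    functions [C -> C]; their values outside [D] are never used. *)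

(* Analytic on [D]: complex differentiable at each point of [D].  Fixing
   [K := C_AbsRing] makes this complex, not real, differentiability. *)
Definition analytic_on_disc (f : C -> C) : Prop :=
  forall z : C, Cmod z < 1 -> ex_derive (K := C_AbsRing) (V := C_NormedModule) f z.

Definition power_series_on_disc (a : nat -> C) (f : C -> C) : Prop :=
  forall z : C, Cmod z < 1 ->
    is_pseries (K := C_AbsRing) (V := C_NormedModule) a z (f z).

(* [f] belongs to [S_mu]; the terms being nonnegative, [ex_series] says that
   the norm is finite.  The base [INR n + 1] of [Rpower] is positive. *)
Definition in_S (mu : R) (f : C -> C) : Prop :=
  analytic_on_disc f /\
  exists a : nat -> C,
    power_series_on_disc a f /\
    ex_series (fun n : nat => Cmod (a n) ^ 2 * Rpower (INR n + 1) (2 * mu)).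

Definition is_min (E : R -> Prop) (m : R) : Prop :=
  E m /\ forall x : R, E x -> m <= x.

Definition modulus_on_circle (f : C -> C) (r : R) : R -> Prop :=
  fun x => exists z : C, Cmod z = r /\ x = Cmod (f z).

(* Main.v *)
(** The function is [f z = sum_k 10^k z^(n_k)] with [n_0 = 1] and
    [n_(k+1) = (100 + k) n_k]. On the circle of radius [1 - 1/(2 n_k)] the k-th
    term has modulus at least [10^k / 2], while the earlier terms add up to at
    most [10^k / 9] and, as [n_j / n_k >= 100^(j-k)], the later ones to at most
    [2 * 10^k / 9]; hence [|f| >= 10^k / 6] there. Since [n_k] grows faster than
    any geometric sequence, [sum_k 100^k n_k^(-2 nu)] converges for all [nu > 0]. *)

Require Import Defs.
From Stdlib Require Import Reals.
From Coquelicot Require Import Coquelicot.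
From Stdlib Require Import Lra Lia ClassicalEpsilon.

(** * Norms of series *)

Lemma series_norm_le {K : AbsRing} {V : NormedModule K} (a : nat -> V) (l : V) (B : R) :
  is_series a l -> (forall M, sum_n (fun n => norm (a n)) M <= B) -> norm l <= B.
Proof.
  intros Ha HB.
  assert (Hl : is_lim_seq (fun M => norm (sum_n a M)) (norm l)).
  { exact (filterlim_comp _ _ _ _ _ _ _ _ Ha (filterlim_norm l)). }
  refine (is_lim_seq_le _ _ (Finite _) (Finite _) _ Hl (is_lim_seq_const B)).
  intros M. eapply Rle_trans; [ | exact (HB M)].
  apply norm_sum_n_m.
Qed.

(* A term dominating all the others of a series bounds the sum from below;
   counting it on both sides avoids deleting it from the series. *)
Lemma norm_dominant_term {K : AbsRing} {V : NormedModule K} (a : nat -> V) (N d : nat) :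
  2 * norm (a N) <= norm (sum_n a (N + d)) + sum_n (fun n => norm (a n)) (N + d).
Proof.
  assert (Htri : forall x y : V, norm y <= norm (plus x y) + norm x).
  { intros x y. rewrite <- (norm_opp x).
    replace (norm y) with (norm (plus (plus x y) (opp x))); [apply norm_triangle|].
    f_equal. rewrite (plus_comm x y), <- plus_assoc.
    transitivity (plus y zero); [f_equal | apply plus_zero_r].
    exact (plus_opp_r (G := NormedModule.AbelianGroup K V) x). }
  induction d as [|d IH].
  - rewrite Nat.add_0_r. destruct N as [|N].
    + rewrite !sum_O. lra.
    + rewrite !sum_Sn. pose proof (Htri (sum_n a N) (a (S N))).
      pose proof (norm_sum_n_m a 0 N). unfold sum_n in *.
      unfold plus at 2; simpl. lra.
  (* One more term lowers the norm of the partial sum by at most its own norm, which is what the sum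
     of the norms gains. *)
  - rewrite Nat.add_succ_r, !sum_Sn.
    pose proof (Htri (a (S (N + d))) (sum_n a (N + d))) as H.
    rewrite plus_comm in H.
    unfold plus at 2; simpl. lra.
Qed.

(** The limit of [norm_dominant_term] as [d] grows. The bound [B] also counts the term at [N]
    itself, hence the factor 2. *)
Lemma series_dominant_term {K : AbsRing} {V : NormedModule K} (a : nat -> V) (l : V)
  (N : nat) (B : R) :
  is_series a l -> (forall M, sum_n (fun n => norm (a n)) M <= B) ->
  2 * norm (a N) - B <= norm l.
Proof.
  intros Ha HB.
  assert (Hl : is_lim_seq (fun d => norm (sum_n a (d + N))) (norm l)).
  { apply (is_lim_seq_incr_n (fun M => norm (sum_n a M)) N).
    exact (filterlim_comp _ _ _ _ _ _ _ _ Ha (filterlim_norm l)). }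
  refine (is_lim_seq_le _ _ (Finite _) (Finite _) _ (is_lim_seq_const _) Hl).
  intros d. rewrite Nat.add_comm.
  pose proof (norm_dominant_term a N d). pose proof (HB (N + d)%nat). lra.
Qed.

Lemma sum_n_S_R (u : nat -> R) (n : nat) : sum_n u (S n) = sum_n u n + u (S n).
Proof. exact (sum_Sn u n). Qed.

Lemma ex_series_bounded (a : nat -> R) (B : R) :
  (forall n, 0 <= a n) -> (forall M, sum_n a M <= B) -> ex_series a.
Proof.
  intros Ha HB.
  destruct (ex_finite_lim_seq_incr (sum_n a) B) as [l Hl].
  - intros n. rewrite sum_n_S_R. specialize (Ha (S n)). lra.
  - exact HB.
  - now exists l.
Qed.

Lemma sum_n_le_series (a : nat -> R) (M : nat) :
  (forall n, 0 <= a n) -> ex_series a -> sum_n a M <= Series a.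
Proof.
  intros Ha Hex.
  apply (is_lim_seq_incr_compare (sum_n a) (Series a)).
  - exact (Series_correct a Hex).
  - intros n. rewrite sum_n_S_R. specialize (Ha (S n)). lra.
Qed.

(** * Complex power series *)

Lemma pow_n_C (z : C) (n : nat) : pow_n (K := C_Ring) z n = Cpow z n.
Proof. induction n as [|n IH]; simpl; [easy|]. now rewrite IH. Qed.

(* [dpow z n] is [n * z ^ (n - 1)]; the recursion is the product rule. *)
Fixpoint dpow (z : C) (n : nat) : C :=
  match n with
  | O => 0
  | S n => z * dpow z n + z ^ n
  end%C.

Lemma Cmod_pow_le (z : C) (r s : R) (n : nat) :
  Cmod z <= r -> r <= s -> Cmod (z ^ n)%C <= s ^ n.
Proof.
  intros Hz Hrs. rewrite Cmod_pow. apply pow_incr.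
  split; [apply Cmod_ge_0 | lra].
Qed.

(** The inductive step of the next three estimates: [dpow z n], the difference of powers and the
    Taylor remainder all satisfy a recursion of the form [x * y + u * v]. *)
Lemma Cmod_sum_mult_le (x y u v : C) (a b c d : R) :
  Cmod x <= a -> Cmod y <= b -> Cmod u <= c -> Cmod v <= d ->
  Cmod (x * y + u * v)%C <= a * b + c * d.
Proof.
  intros. eapply Rle_trans; [apply Cmod_triangle|]. rewrite !Cmod_mult.
  apply Rplus_le_compat; apply Rmult_le_compat; auto using Cmod_ge_0.
Qed.

Lemma dpow_le (z : C) (r s : R) (n : nat) :
  Cmod z <= r -> r < s -> Cmod (dpow z n) <= s ^ n / (s - r).
Proof.
  intros Hz Hrs. pose proof (Cmod_ge_0 z).
  induction n as [|n IH]; simpl.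
  - rewrite Cmod_0. apply Rlt_le, Rdiv_lt_0_compat; lra.
  - replace (z * dpow z n + z ^ n)%C with (z * dpow z n + 1 * z ^ n)%C by ring.
    replace (s * s ^ n / (s - r)) with (r * (s ^ n / (s - r)) + 1 * s ^ n) by (field; lra).
    apply Cmod_sum_mult_le; auto.
    + rewrite Cmod_1; lra.
    + apply Cmod_pow_le with r; lra.
Qed.

(* Here and in [Cpow_taylor_le], the room between [r] and [s] absorbs the
   factors [n] and [n ^ 2] of the mean value estimates, since
   [r * (s ^ n / (s - r)) + s ^ n = s ^ S n / (s - r)]. *)
Lemma Cpow_sub_le (z w : C) (r s : R) (n : nat) :
  Cmod z <= r -> Cmod w <= r -> r < s ->
  Cmod (w ^ n - z ^ n)%C <= Cmod (w - z)%C * (s ^ n / (s - r)).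
Proof.
  intros Hz Hw Hrs. pose proof (Cmod_ge_0 z).
  induction n as [|n IH].
  - simpl. replace (1 - 1)%C with (RtoC 0) by ring. rewrite Cmod_0.
    apply Rmult_le_pos; [apply Cmod_ge_0|]. apply Rlt_le, Rdiv_lt_0_compat; lra.
  - replace (w ^ S n - z ^ S n)%C with (w * (w ^ n - z ^ n) + (w - z) * z ^ n)%C
      by (simpl; ring).
    replace (Cmod (w - z)%C * (s ^ S n / (s - r)))
      with (r * (Cmod (w - z)%C * (s ^ n / (s - r))) + Cmod (w - z)%C * s ^ n)
      by (simpl; field; lra).
    apply Cmod_sum_mult_le; auto; [lra|].
    apply Cmod_pow_le with r; lra.
Qed.

Lemma Cpow_taylor_le (z w : C) (r s : R) (n : nat) :
  Cmod z <= r -> Cmod w <= r -> r < s ->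
  Cmod (w ^ n - z ^ n - (w - z) * dpow z n)%C
    <= Cmod (w - z)%C ^ 2 * (s ^ n / (s - r) ^ 2).
Proof.
  intros Hz Hw Hrs. pose proof (Cmod_ge_0 z).
  induction n as [|n IH].
  - simpl. replace (1 - 1 - (w - z) * 0)%C with (RtoC 0) by ring. rewrite Cmod_0.
    apply Rmult_le_pos; [apply pow2_ge_0|].
    apply Rlt_le, Rdiv_lt_0_compat; [lra|]. apply (pow_lt (s - r) 2). lra.
  (* The new remainder is [z] times the old one plus [w - z] times the difference of powers, so
     [Cpow_sub_le] supplies the second factor [w - z]. *)
  - replace (w ^ S n - z ^ S n - (w - z) * dpow z (S n))%C
      with (z * (w ^ n - z ^ n - (w - z) * dpow z n) + (w - z) * (w ^ n - z ^ n))%C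
      by (simpl; ring).
    replace (Cmod (w - z)%C ^ 2 * (s ^ S n / (s - r) ^ 2))
      with (r * (Cmod (w - z)%C ^ 2 * (s ^ n / (s - r) ^ 2))
            + Cmod (w - z)%C * (Cmod (w - z)%C * (s ^ n / (s - r))))
      by (simpl; field; lra).
    apply Cmod_sum_mult_le; auto; [lra|].
    now apply Cpow_sub_le.
Qed.

Lemma ex_power_series (a : nat -> C) :
  (forall r, 0 <= r < 1 -> ex_series (fun n => Cmod (a n) * r ^ n)) ->
  exists f, power_series_on_disc a f.
Proof.
  intros Habs.
  assert (Hz : forall z : C, exists l : C, Cmod z < 1 ->
    is_pseries (K := C_AbsRing) (V := C_NormedModule) a z l).
  { intros z. destruct (Rlt_dec (Cmod z) 1) as [Hz|Hz]; [|now exists z].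
    assert (Hex : ex_series (V := C_CompleteNormedModule)
      (fun k => scal (pow_n (K := C_Ring) z k) (a k))).
    { apply (ex_series_le (V := C_CompleteNormedModule))
        with (2 := Habs (Cmod z) (conj (Cmod_ge_0 z) Hz)).
      intros n. rewrite pow_n_C. change (Cmod (z ^ n * a n)%C <= Cmod (a n) * Cmod z ^ n).
      rewrite Cmod_mult, Cmod_pow. lra. }
    destruct Hex as [l Hl]. now exists l. }
  exists (fun z => proj1_sig (constructive_indefinite_description _ (Hz z))).
  intros z. exact (proj2_sig (constructive_indefinite_description _ (Hz z))).
Qed.

(** Termwise differentiation: summing [Cpow_taylor_le] against the coefficients bounds the
    first-order remainder of [f] by a constant times the square of [Cmod (w - z)]. *)
Lemma power_series_analytic (a : nat -> C) (f : C -> C) :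
  (forall r, 0 <= r < 1 -> ex_series (fun n => Cmod (a n) * r ^ n)) ->
  power_series_on_disc a f -> analytic_on_disc f.
Proof.
  intros Habs Hf z Hz.
  pose proof (Cmod_ge_0 z) as Hz0.
  (* A third of the distance to the unit circle leaves room for two further radii,
     [Cmod z < r < s < 1]: points within [d] of [z] have modulus at most [r], and absolute
     convergence is used at [s]. *)
  set (d := (1 - Cmod z) / 3).
  set (r := Cmod z + d). set (s := r + d).
  assert (Hd : 0 < d) by (unfold d; lra).
  assert (Hs : 0 <= s < 1) by (unfold s, r, d; lra).
  assert (Hr : 0 <= r < 1) by (unfold r, d; lra).
  assert (Hrs : r < s) by (unfold s; lra).
  assert (Hzr : Cmod z <= r) by (unfold r; lra).
  pose proof (Habs s Hs) as HS.
  set (B := Series (fun n => Cmod (a n) * s ^ n)) in *.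
  assert (Hpos : forall n, 0 <= Cmod (a n) * s ^ n).
  { intros n. apply Rmult_le_pos; [apply Cmod_ge_0 | apply pow_le; lra]. }
  assert (Hg : ex_series (V := C_CompleteNormedModule) (fun n => (dpow z n * a n)%C)).
  { apply (ex_series_le (V := C_CompleteNormedModule))
      with (b := fun n => / (s - r) * (Cmod (a n) * s ^ n)).
    - intros n. change (Cmod (dpow z n * a n)%C <= / (s - r) * (Cmod (a n) * s ^ n)).
      rewrite Cmod_mult.
      replace (/ (s - r) * (Cmod (a n) * s ^ n)) with (s ^ n / (s - r) * Cmod (a n))
        by (field; lra).
      apply Rmult_le_compat_r; [apply Cmod_ge_0|]. now apply dpow_le.
    - exact (ex_series_scal_l (/ (s - r)) _ HS). }
  destruct Hg as [g Hg].
  assert (Hmain : forall w, Cmod w <= r ->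
    Cmod (f w - f z - (w - z) * g)%C <= Cmod (w - z)%C ^ 2 * (B / (s - r) ^ 2)).
  { intros w Hw.
    assert (Hser : is_series (V := C_NormedModule)
      (fun n => (a n * (w ^ n - z ^ n - (w - z) * dpow z n))%C)
      (f w - f z - (w - z) * g)%C).
    { pose proof (is_series_minus _ _ _ _
        (is_series_minus _ _ _ _ (Hf w ltac:(lra)) (Hf z Hz))
        (is_series_scal_l (V := C_NormedModule) (w - z)%C _ _ Hg)) as H.
      eapply is_series_ext; [|exact H]. intros n. cbv beta. rewrite !pow_n_C.
      change (w ^ n * a n - z ^ n * a n - (w - z) * (dpow z n * a n)
              = a n * (w ^ n - z ^ n - (w - z) * dpow z n))%C. ring. }
    apply (series_norm_le _ _ _ Hser). intros M.
    set (e := Cmod (w - z)%C ^ 2 * / (s - r) ^ 2).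
    assert (Hsr : 0 < (s - r) ^ 2) by (apply pow_lt; lra).
    assert (He : 0 <= e).
    { apply Rmult_le_pos; [apply pow2_ge_0|]. now apply Rlt_le, Rinv_0_lt_compat. }
    replace (Cmod (w - z)%C ^ 2 * (B / (s - r) ^ 2)) with (e * B) by (unfold e; field; lra).
    apply Rle_trans with (e * sum_n (fun n => Cmod (a n) * s ^ n) M).
    - change (e * sum_n (fun n => Cmod (a n) * s ^ n) M)
        with (mult (K := R_Ring) e (sum_n (fun n => Cmod (a n) * s ^ n) M)).
      rewrite <- (sum_n_mult_l (K := R_Ring)).
      apply sum_n_m_le. intros n.
      change (Cmod (a n * (w ^ n - z ^ n - (w - z) * dpow z n))%C
              <= e * (Cmod (a n) * s ^ n)).
      rewrite Cmod_mult.
      replace (e * (Cmod (a n) * s ^ n))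
        with (Cmod (a n) * (Cmod (w - z)%C ^ 2 * (s ^ n / (s - r) ^ 2)))
        by (unfold e; field; lra).
      apply Rmult_le_compat_l; [apply Cmod_ge_0|]. now apply Cpow_taylor_le.
    - apply Rmult_le_compat_l; [exact He|]. now apply sum_n_le_series. }
  exists g. split; [apply is_linear_scal_l|].
  intros x Hx.
  (* Differentiability is stated at every limit of the filter; the only one is [z]. *)
  apply (is_filter_lim_locally_unique (V := AbsRing_NormedModule C_AbsRing)) in Hx. subst x.
  intros eps.
  assert (HB : 0 <= B / (s - r) ^ 2).
  { apply Rmult_le_pos.
    - eapply Rle_trans; [apply (Hpos O)|].
      pose proof (sum_n_le_series _ O Hpos HS) as H. now rewrite sum_O in H.
    - apply Rlt_le, Rinv_0_lt_compat, pow_lt. lra. }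
  set (D := B / (s - r) ^ 2) in *.
  pose proof (cond_pos eps) as Heps.
  (* The first bound keeps [w] in the disc of radius [r], the second makes [D * Cmod (w - z)] at
     most [eps]; [D + 1] avoids dividing by zero. *)
  assert (He : 0 < Rmin d (eps / (D + 1))).
  { apply Rmin_pos; [easy|]. apply Rdiv_lt_0_compat; lra. }
  exists (mkposreal _ He). intros w Hw.
  change (Cmod (w - z)%C < Rmin d (eps / (D + 1))) in Hw.
  change (Cmod (f w - f z - (w - z) * g)%C <= eps * Cmod (w - z)%C).
  pose proof (Rmin_l d (eps / (D + 1))). pose proof (Rmin_r d (eps / (D + 1))).
  eapply Rle_trans; [apply Hmain|].
  - replace w with (z + (w - z))%C by ring.
    eapply Rle_trans; [apply Cmod_triangle|]. unfold r. lra.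
  - pose proof (Cmod_ge_0 (w - z)%C).
    replace (Cmod (w - z)%C ^ 2 * D) with (Cmod (w - z)%C * D * Cmod (w - z)%C) by ring.
    apply Rmult_le_compat_r; [easy|].
    apply Rle_trans with (eps / (D + 1) * D).
    + apply Rmult_le_compat_r; lra.
    + replace (eps / (D + 1) * D) with (eps - eps / (D + 1)) by (field; lra).
      assert (0 < eps / (D + 1)) by (apply Rdiv_lt_0_compat; lra). lra.
Qed.

(** * The minimum on a circle *)

(** The real part fixes the angle up to sign as [acos (x / r)], and the sign of the imaginary part
    decides between the two. The compact range of angles serves the extreme value theorem below. *)
Lemma Cmod_polar (z : C) :
  exists t, - PI <= t <= PI /\ z = (Cmod z * cos t, Cmod z * sin t).
Proof.
  destruct (Req_dec (Cmod z) 0) as [H0|H0].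
  { exists 0. pose proof PI_RGT_0. split; [lra|].
    rewrite H0, !Rmult_0_l. now apply Cmod_eq_0. }
  destruct z as [x y]. set (r := Cmod (x, y)) in *.
  assert (Hr : 0 < r) by (pose proof (Cmod_ge_0 (x, y)); unfold r in *; lra).
  assert (Hxy : r * r = x * x + y * y).
  { unfold r, Cmod. cbn [fst snd]. rewrite sqrt_sqrt; [ring|]. nra. }
  assert (Hx : -1 <= x / r <= 1).
  { pose proof (re_le_Cmod (x, y)) as Hre. apply Rabs_le_between in Hre.
    fold r in Hre. cbn [Re fst] in Hre.
    split; apply Rmult_le_reg_r with r; try easy; unfold Rdiv;
      rewrite Rmult_assoc, Rinv_l by easy; lra. }
  assert (Hsin : r * sin (acos (x / r)) = Rabs y).
  { rewrite sin_acos by easy. rewrite <- (sqrt_Rsqr r) at 1 by lra.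
    rewrite <- sqrt_mult_alt by apply Rle_0_sqr.
    rewrite <- sqrt_Rsqr_abs. f_equal. unfold Rsqr.
    replace (y * y) with (r * r - x * x) by lra. now field. }
  assert (Hcos : r * cos (acos (x / r)) = x).
  { rewrite cos_acos by easy. now field. }
  pose proof (acos_bound (x / r)) as Hb.
  destruct (Rle_dec 0 y) as [Hy|Hy].
  - exists (acos (x / r)). split; [lra|].
    rewrite Hcos, Hsin, Rabs_pos_eq by easy. easy.
  - exists (- acos (x / r)). split; [lra|].
    rewrite cos_neg, sin_neg, Hcos, Ropp_mult_distr_r_reverse, Hsin, Rabs_left by lra.
    f_equal. ring.
Qed.

(** Extreme value theorem for the continuous map sending [t] to [Cmod (f (c t))] on the compact
    interval from [- PI] to [PI], whose image under [c] is the whole circle. *)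
Lemma circle_min (f : C -> C) (r : R) :
  analytic_on_disc f -> 0 < r < 1 -> exists m, is_min (modulus_on_circle f r) m.
Proof.
  intros Hf Hr.
  set (c := fun t => (r * cos t, r * sin t) : C).
  assert (Hc : forall t, Cmod (c t) = r).
  { intros t. unfold Cmod, c. cbn [fst snd].
    replace ((r * cos t) ^ 2 + (r * sin t) ^ 2)
      with (Rsqr r * (Rsqr (sin t) + Rsqr (cos t))) by (unfold Rsqr; ring).
    rewrite sin2_cos2, Rmult_1_r. apply sqrt_Rsqr. lra. }
  destruct (continuity_ab_min (fun t => Cmod (f (c t))) (- PI) PI) as [t0 [Hmin _]].
  - pose proof PI_RGT_0. lra.
  - intros t _. apply continuity_pt_filterlim.
    apply (continuous_comp (U := R_UniformSpace) (V := C_UniformSpace) (W := R_UniformSpace)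
             (fun t => f (c t)) Cmod).
    + apply (continuous_comp (U := R_UniformSpace) (V := C_UniformSpace) (W := C_UniformSpace) c f).
      * apply (continuous_comp_2 (U := R_UniformSpace) (V := R_UniformSpace) (W := R_UniformSpace)
          (X := C_UniformSpace) (fun t => r * cos t) (fun t => r * sin t) (fun x y => (x, y))).
        -- apply continuity_pt_filterlim. apply derivable_continuous_pt. reg.
        -- apply continuity_pt_filterlim. apply derivable_continuous_pt. reg.
        -- intros P HP. unfold filtermap. apply (filter_imp P); [|exact HP]. now intros [x y].
      * assert (Hct : Cmod (c t) < 1) by (rewrite Hc; lra).
        (* [C] as an absolute ring and [C] as a product [R * R] carry
           different uniform structures. *)
        intros P HP. apply (locally_le_locally_norm (V := C_NormedModule)).
        exact (ex_derive_continuous (K := C_AbsRing) (V := C_NormedModule) _ _ (Hf _ Hct) P HP).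
    + exact (filterlim_norm (V := C_NormedModule) (f (c t))).
  - exists (Cmod (f (c t0))). split.
    + exists (c t0). now split.
    + intros x (z & Hz & ->). destruct (Cmod_polar z) as (t & Ht & Hzt).
      rewrite Hz in Hzt. rewrite Hzt. now apply Hmin.
Qed.

(** * Lacunary sequences *)

Lemma strict_mono_lt (phi : nat -> nat) :
  (forall k, (phi k < phi (S k))%nat) -> forall j k, (j < k)%nat -> (phi j < phi k)%nat.
Proof. intros Hphi j k Hjk. induction Hjk; [|specialize (Hphi m)]; auto; lia. Qed.

Lemma strict_mono_ge (phi : nat -> nat) :
  (forall k, (phi k < phi (S k))%nat) -> forall k, (k <= phi k)%nat.
Proof. intros Hphi k. induction k; [lia|specialize (Hphi k); lia]. Qed.

Lemma sum_n_le_index (u : nat -> R) (m n : nat) :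
  (forall k, 0 <= u k) -> (m <= n)%nat -> sum_n u m <= sum_n u n.
Proof.
  intros Hu Hmn. induction Hmn as [|n Hmn IH]; [lra|].
  rewrite sum_n_S_R. specialize (Hu (S n)). lra.
Qed.

Lemma sum_n_zero_after (u : nat -> R) (m n : nat) :
  (m <= n)%nat -> (forall k, (m < k <= n)%nat -> u k = 0) -> sum_n u n = sum_n u m.
Proof.
  intros Hmn. induction Hmn as [|n Hmn IH]; intros Hu; [easy|].
  rewrite sum_n_S_R, IH by (intros; apply Hu; lia).
  rewrite Hu by lia. apply Rplus_0_r.
Qed.

Lemma sum_n_zero_before (u : nat -> R) (m : nat) :
  (forall n, (n < m)%nat -> u n = 0) -> sum_n u m = u m.
Proof.
  destruct m as [|m]; intros Hu; [apply sum_O|].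
  rewrite sum_n_S_R, (sum_n_zero_after u 0 m), sum_O, Hu by (intros; try apply Hu; lia).
  apply Rplus_0_l.
Qed.

(** The coefficient of [z ^ n] in the series of the [c k * z ^ phi k]. Stopping the sum at [n] loses
    nothing for strictly increasing [phi], since then [k <= phi k]. *)
Definition lacunary (phi : nat -> nat) (c : nat -> R) (n : nat) : R :=
  sum_n (fun k => if Nat.eqb (phi k) n then c k else 0) n.

Lemma lacunary_nonneg (phi : nat -> nat) (c : nat -> R) (n : nat) :
  (forall k, 0 <= c k) -> 0 <= lacunary phi c n.
Proof.
  intros Hc. unfold lacunary.
  apply Rle_trans with (sum_n (fun _ => 0) n).
  - rewrite sum_n_const. lra.
  - apply sum_n_m_le. intros k. destruct (Nat.eqb (phi k) n); [apply Hc | lra].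
Qed.

Lemma lacunary_other (phi : nat -> nat) (c : nat -> R) (n : nat) :
  (forall k, phi k <> n) -> lacunary phi c n = 0.
Proof.
  intros Hn. unfold lacunary.
  rewrite (sum_n_ext _ (fun _ => 0)).
  - rewrite sum_n_const. ring.
  - intros k. destruct (Nat.eqb_spec (phi k) n); [now destruct (Hn k) | easy].
Qed.

Lemma lacunary_at (phi : nat -> nat) (c : nat -> R) (k : nat) :
  (forall k, (phi k < phi (S k))%nat) -> lacunary phi c (phi k) = c k.
Proof.
  intros Hphi. unfold lacunary.
  pose proof (strict_mono_ge phi Hphi k) as Hk.
  rewrite (sum_n_zero_after _ k), sum_n_zero_before; [ | | easy | ].
  - now rewrite Nat.eqb_refl.
  - intros j Hj. pose proof (strict_mono_lt phi Hphi j k Hj).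
    destruct (Nat.eqb_spec (phi j) (phi k)); [lia | easy].
  - intros j Hj. pose proof (strict_mono_lt phi Hphi k j ltac:(lia)).
    destruct (Nat.eqb_spec (phi j) (phi k)); [lia | easy].
Qed.

(** The coefficients strictly between [phi k] and [phi (S k)] vanish, so passing from one exponent
    to the next adds a single term. *)
Lemma sum_n_lacunary (phi : nat -> nat) (c : nat -> R) (g : nat -> R) (k : nat) :
  (forall k, (phi k < phi (S k))%nat) ->
  sum_n (fun n => lacunary phi c n * g n) (phi k) = sum_n (fun j => c j * g (phi j)) k.
Proof.
  intros Hphi. induction k as [|k IH].
  - rewrite sum_n_zero_before, lacunary_at, sum_O; [easy | exact Hphi |].
    intros n Hn. rewrite lacunary_other; [ring|]. intros [|j]; [lia|].
    pose proof (strict_mono_lt phi Hphi 0 (S j)). lia.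
  - rewrite sum_n_S_R, <- IH. pose proof (Hphi k) as Hk.
    rewrite <- (lacunary_at phi c (S k) Hphi).
    destruct (phi (S k)) as [|p] eqn:Hp; [lia|].
    rewrite sum_n_S_R, (sum_n_zero_after _ (phi k) p); [easy | lia |].
    + intros n Hn. rewrite lacunary_other; [ring|]. intros j Hj.
      destruct (Nat.lt_trichotomy j k) as [H|[->|H]]; [|lia|].
      * pose proof (strict_mono_lt phi Hphi j k H). lia.
      * destruct (Nat.eq_dec j (S k)) as [->|]; [lia|].
        pose proof (strict_mono_lt phi Hphi (S k) j). lia.
Qed.

(** As [M <= phi M], lengthening the left sum up to [phi M] only adds nonnegative terms and reaches
    the case of equality. *)
Lemma sum_n_lacunary_le (phi : nat -> nat) (c : nat -> R) (g : nat -> R) (M : nat) :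
  (forall k, (phi k < phi (S k))%nat) ->
  (forall k, 0 <= c k) -> (forall n, 0 <= g n) ->
  sum_n (fun n => lacunary phi c n * g n) M <= sum_n (fun j => c j * g (phi j)) M.
Proof.
  intros Hphi Hc Hg. rewrite <- (sum_n_lacunary phi c g M Hphi). apply sum_n_le_index.
  - intros n. apply Rmult_le_pos; [now apply lacunary_nonneg | easy].
  - now apply strict_mono_ge.
Qed.

(** * The frequencies, the radii and the coefficients *)

Fixpoint freq (k : nat) : nat :=
  match k with
  | O => 1
  | S k => (100 + k) * freq k
  end.

Lemma freq_S (k : nat) : INR (freq (S k)) = (100 + INR k) * INR (freq k).
Proof.
  change (freq (S k)) with ((100 + k) * freq k)%nat.
  rewrite mult_INR, plus_INR, (INR_IZR_INZ 100). easy.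
Qed.

Lemma freq_pos (k : nat) : (0 < freq k)%nat.
Proof. induction k; simpl; lia. Qed.

Lemma INR_freq_ge1 (k : nat) : 1 <= INR (freq k).
Proof. apply (le_INR 1), freq_pos. Qed.

Lemma freq_incr (k : nat) : (freq k < freq (S k))%nat.
Proof. pose proof (freq_pos k). simpl. lia. Qed.

Lemma freq_growth (k i : nat) : 100 ^ i * INR (freq k) <= INR (freq (k + i)).
Proof.
  induction i as [|i IH].
  - rewrite Nat.add_0_r. simpl. lra.
  - rewrite Nat.add_succ_r, freq_S. simpl.
    pose proof (pos_INR (k + i)). pose proof (pos_INR (freq (k + i))). nra.
Qed.

(* Bernoulli's inequalities give [radius k ^ freq k >= 1/2] and
   [radius k ^ freq j <= 2 * freq k / freq j]. *)
Definition radius (k : nat) : R := 1 - / (2 * INR (freq k)).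

Lemma radius_bound (k : nat) : 0 < radius k < 1.
Proof.
  unfold radius. pose proof (INR_freq_ge1 k).
  assert (0 < / (2 * INR (freq k)) <= / 2).
  { split; [apply Rinv_0_lt_compat | apply Rinv_le_contravar]; lra. }
  lra.
Qed.

Lemma radius_incr (k : nat) : radius k < radius (S k).
Proof.
  unfold radius. pose proof (INR_freq_ge1 k). pose proof (lt_INR _ _ (freq_incr k)).
  assert (/ (2 * INR (freq (S k))) < / (2 * INR (freq k))).
  { apply Rinv_lt_contravar; [apply Rmult_lt_0_compat|]; lra. }
  lra.
Qed.

Lemma is_lim_radius : is_lim_seq radius 1.
Proof.
  unfold radius. replace (Finite 1) with (Finite (1 - 0)) by (f_equal; ring).
  apply is_lim_seq_minus'; [apply is_lim_seq_const|].
  apply (is_lim_seq_inv _ p_infty); [|easy].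
  apply is_lim_seq_le_p_loc with INR; [|apply is_lim_seq_INR].
  exists O. intros k _. pose proof (le_INR _ _ (strict_mono_ge freq freq_incr k)).
  pose proof (INR_freq_ge1 k). lra.
Qed.

(** * Size of the terms on the circle of radius [radius k] *)

Lemma bernoulli_sub (x : R) (n : nat) : 0 <= x <= 1 -> 1 - INR n * x <= (1 - x) ^ n.
Proof.
  intros Hx. induction n as [|n IH]; [simpl; lra|].
  rewrite S_INR. simpl. pose proof (pos_INR n).
  assert (0 <= (1 - x) ^ n) by (apply pow_le; lra). nra.
Qed.

(** Bernoulli's inequality ([poly]) bounds the second factor by [(1 + x) ^ n], and
    [(1 - x) * (1 + x) <= 1]. *)
Lemma pow_sub_mul_le (x : R) (n : nat) : 0 < x <= 1 -> (1 - x) ^ n * (1 + INR n * x) <= 1.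
Proof.
  intros Hx. apply Rle_trans with ((1 - x) ^ n * (1 + x) ^ n).
  - apply Rmult_le_compat_l; [apply pow_le; lra|]. apply poly. lra.
  - rewrite <- Rpow_mult_distr.
    apply Rle_trans with (1 ^ n); [apply pow_incr; nra | rewrite pow1; lra].
Qed.

Lemma sum_n_pow10_le (m : nat) : sum_n (fun j => 10 ^ j) m <= 10 ^ S m / 9.
Proof.
  induction m as [|m IH].
  - rewrite sum_O. simpl. lra.
  - rewrite sum_n_S_R. simpl in *. lra.
Qed.

(** The modulus of the [j]-th summand of the function on the [k]-th circle. *)
Definition term (k j : nat) : R := 10 ^ j * radius k ^ freq j.

Lemma term_nonneg (k j : nat) : 0 <= term k j.
Proof. apply Rmult_le_pos; apply pow_le; [lra | apply Rlt_le, radius_bound]. Qed.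

Lemma term_le (k j : nat) : term k j <= 10 ^ j.
Proof.
  unfold term. rewrite <- (Rmult_1_r (10 ^ j)) at 2.
  apply Rmult_le_compat_l; [apply pow_le; lra|].
  rewrite <- (pow1 (freq j)). apply pow_incr. pose proof (radius_bound k). lra.
Qed.

Lemma term_diag_ge (k : nat) : 10 ^ k / 2 <= term k k.
Proof.
  unfold term, Rdiv. apply Rmult_le_compat_l; [apply pow_le; lra|].
  pose proof (INR_freq_ge1 k). pose proof (radius_bound k). unfold radius in *.
  replace (/ 2) with (1 - INR (freq k) * / (2 * INR (freq k))) by (field; lra).
  apply bernoulli_sub. lra.
Qed.

(** With [x = / (2 * INR (freq k))], [pow_sub_mul_le] and [freq_growth] bound the power of the
    radius by [2 / 100 ^ i], which beats the coefficient [10 ^ (k + i)]. *)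
Lemma term_tail_le (k i : nat) : term k (k + i) <= 2 * 10 ^ k * / 10 ^ i.
Proof.
  unfold term. rewrite pow_add.
  pose proof (INR_freq_ge1 k). pose proof (radius_bound k).
  pose proof (freq_growth k i) as Hg.
  assert (Hp : radius k ^ freq (k + i) * (1 + INR (freq (k + i)) * / (2 * INR (freq k))) <= 1).
  { apply pow_sub_mul_le. unfold radius in *. lra. }
  assert (Hp0 : 0 <= radius k ^ freq (k + i)) by (apply pow_le; lra).
  set (p := radius k ^ freq (k + i)) in *.
  assert (Hq : 100 ^ i / 2 <= INR (freq (k + i)) * / (2 * INR (freq k))).
  { replace (100 ^ i / 2) with (100 ^ i * INR (freq k) * / (2 * INR (freq k))) by (field; lra).
    apply Rmult_le_compat_r; [apply Rlt_le, Rinv_0_lt_compat; lra | exact Hg]. }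
  assert (Hpq : p * (100 ^ i / 2) <= 1) by nra.
  assert (H10 : 0 < 10 ^ i) by (apply pow_lt; lra).
  assert (H10k : 0 < 10 ^ k) by (apply pow_lt; lra).
  replace (100 ^ i) with (10 ^ i * 10 ^ i) in Hpq
    by (rewrite <- Rpow_mult_distr; f_equal; lra).
  apply Rmult_le_reg_r with (10 ^ i); [easy|].
  replace (2 * 10 ^ k * / 10 ^ i * 10 ^ i) with (10 ^ k * 2) by (field; lra).
  replace (10 ^ k * 10 ^ i * p * 10 ^ i) with (10 ^ k * (p * (10 ^ i * 10 ^ i / 2) * 2)) by field.
  apply Rmult_le_compat_l; lra.
Qed.

Lemma sum_term_le (k M : nat) : sum_n (term k) M <= term k k + 10 ^ k / 3.
Proof.
  (* Up to [k + M] the sum splits at [k], whatever [M] is; the earlier terms give [10 ^ k / 9] and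
     the later ones [2 * 10 ^ k / 9], together [10 ^ k / 3]. *)
  apply Rle_trans with (sum_n (term k) (k + M)).
  { apply sum_n_le_index; [apply term_nonneg | lia]. }
  assert (Hk : sum_n (term k) k <= term k k + 10 ^ k / 9).
  { assert (H10k : 0 < 10 ^ k) by (apply pow_lt; lra).
    destruct k as [|k]; [rewrite sum_O; lra|].
    rewrite sum_n_S_R.
    pose proof (sum_n_pow10_le k).
    assert (sum_n (term (S k)) k <= sum_n (fun j => 10 ^ j) k).
    { apply sum_n_m_le. apply term_le. }
    lra. }
  (* The exact value of the finite geometric sum of the bounds [2 * 10 ^ k / 10 ^ i] makes the
     induction close. *)
  assert (Hi : sum_n (term k) (k + M) <= sum_n (term k) k + 2 * 10 ^ k / 9 * (1 - / 10 ^ M)).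
  { clear Hk. induction M as [|M IH].
    - rewrite Nat.add_0_r. simpl. lra.
    - pose proof (term_tail_le k (S M)) as Ht. rewrite Nat.add_succ_r in *.
      rewrite sum_n_S_R.
      assert (H10 : 0 < 10 ^ M) by (apply pow_lt; lra).
      replace (/ 10 ^ S M) with (/ 10 ^ M / 10) in * by (simpl; field; lra).
      lra. }
  assert (0 < / 10 ^ M) by (apply Rinv_0_lt_compat, pow_lt; lra).
  assert (H10k : 0 < 10 ^ k) by (apply pow_lt; lra). nra.
Qed.

(** * The Taylor coefficients: convergence in the disc and the weighted norms *)

Definition coeff : nat -> R := lacunary freq (fun k => 10 ^ k).

Lemma coeff_nonneg (n : nat) : 0 <= coeff n.
Proof. apply lacunary_nonneg. intros k. apply pow_le. lra. Qed.

(** Used twice: for absolute convergence inside the disc, and as the bound [B] of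
    [series_dominant_term]. *)
Lemma sum_coeff_le (k M : nat) :
  sum_n (fun n => coeff n * radius k ^ n) M <= term k k + 10 ^ k / 3.
Proof.
  eapply Rle_trans; [|apply (sum_term_le k M)].
  apply (sum_n_lacunary_le freq (fun k => 10 ^ k) (fun n => radius k ^ n) M freq_incr).
  - intros j. apply pow_le. lra.
  - intros n. apply pow_le. apply Rlt_le, radius_bound.
Qed.

Lemma coeff_abs_conv (r : R) : 0 <= r < 1 -> ex_series (fun n => coeff n * r ^ n).
Proof.
  intros Hr.
  (* Some [radius k] exceeds [r], and on that circle the partial sums are already bounded. *)
  destruct (is_lim_radius (fun x => r < x)) as [k Hk].
  { exists (mkposreal (1 - r) ltac:(lra)). intros y Hy.
    apply Rabs_lt_between in Hy. unfold minus, plus, opp in Hy; simpl in Hy. lra. }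
  specialize (Hk k (le_n k)).
  apply ex_series_bounded with (B := term k k + 10 ^ k / 3).
  - intros n. apply Rmult_le_pos; [apply coeff_nonneg | apply pow_le; lra].
  - intros M. eapply Rle_trans; [|apply (sum_coeff_le k M)].
    apply sum_n_m_le. intros n. apply Rmult_le_compat_l; [apply coeff_nonneg|].
    apply pow_incr. lra.
Qed.

Lemma is_lim_seq_Rpower_neg (y : R) :
  y < 0 -> is_lim_seq (fun n => Rpower (100 + INR n) y) 0.
Proof.
  intros Hy. unfold Rpower.
  apply (is_lim_comp_seq exp _ m_infty 0); [apply is_lim_exp_m | now exists O |].
  replace m_infty with (Rbar_mult y p_infty)
    by now apply is_Rbar_mult_unique, is_Rbar_mult_sym, is_Rbar_mult_p_infty_neg.
  apply is_lim_seq_scal_l.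
  apply (is_lim_comp_seq ln _ p_infty p_infty); [apply is_lim_ln_p | now exists O |].
  apply is_lim_seq_le_p_loc with INR; [|apply is_lim_seq_INR].
  exists O. intros n _. lra.
Qed.

(** Ratio test on [100 ^ j * Rpower (INR (freq j)) (2 * - nu)]: the ratio is
    [100 * Rpower (100 + INR j) (2 * - nu)], which tends to 0 for each positive [nu] because the
    factor [100 + j] is unbounded. *)
Lemma coeff_weighted_summable (nu : R) :
  0 < nu -> ex_series (fun n => coeff n ^ 2 * Rpower (INR n + 1) (2 * - nu)).
Proof.
  intros Hnu.
  assert (HD : ex_series (fun j => Rabs (100 ^ j * Rpower (INR (freq j)) (2 * - nu)))).
  { assert (Hp : forall j, 0 < 100 ^ j * Rpower (INR (freq j)) (2 * - nu)).
    { intros j. apply Rmult_lt_0_compat; [apply pow_lt; lra | apply exp_pos]. }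
    apply ex_series_DAlembert with 0; [lra | intros j; specialize (Hp j); lra |].
    apply is_lim_seq_ext with (fun j => 100 * Rpower (100 + INR j) (2 * - nu)).
    - intros j. rewrite Rabs_pos_eq by (apply Rlt_le, Rdiv_lt_0_compat; apply Hp).
      pose proof (INR_freq_ge1 j). pose proof (pos_INR j).
      rewrite freq_S, <- Rpower_mult_distr by lra. simpl. field. split.
      + apply Rgt_not_eq, exp_pos.
      + apply pow_nonzero. lra.
    - replace (Finite 0) with (Rbar_mult 100 0) by (simpl; f_equal; ring).
      apply is_lim_seq_scal_l, is_lim_seq_Rpower_neg. lra. }
  apply ex_series_bounded
    with (B := Series (fun j => Rabs (100 ^ j * Rpower (INR (freq j)) (2 * - nu)))).
  { intros n. apply Rmult_le_pos; [apply pow2_ge_0 | apply Rlt_le, exp_pos]. }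
  intros M. eapply Rle_trans; [|apply (sum_n_le_series _ M (fun j => Rabs_pos _) HD)].
  (* The lacunary sum is linear in its coefficients, so one factor of the square goes into the
     weight, to be evaluated by [lacunary_at] afterwards. *)
  rewrite (sum_n_ext _ (fun n => coeff n * (coeff n * Rpower (INR n + 1) (2 * - nu))))
    by (intros; simpl; ring).
  eapply Rle_trans.
  { apply (sum_n_lacunary_le freq (fun k => 10 ^ k)
      (fun n => coeff n * Rpower (INR n + 1) (2 * - nu)) M freq_incr).
    - intros j. apply pow_le. lra.
    - intros n. apply Rmult_le_pos; [apply coeff_nonneg | apply Rlt_le, exp_pos]. }
  apply sum_n_m_le. intros j. eapply Rle_trans; [|apply Rle_abs].
  unfold coeff. rewrite lacunary_at by exact freq_incr.
  replace 100 with (10 * 10) by ring. rewrite Rpow_mult_distr, Rmult_assoc.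
  pose proof (INR_freq_ge1 j).
  repeat (apply Rmult_le_compat_l; [apply pow_le; lra|]).
  (* The exponent is negative, so replacing the base [n + 1] by [n] increases the weight; this is
     checked on the inverses. *)
  replace (2 * - nu) with (- (2 * nu)) by ring. rewrite !Rpower_Ropp.
  apply Rinv_le_contravar; [apply exp_pos|]. apply Rle_Rpower_l; lra.
Qed.

Theorem proposition2p7 :
  exists f : C -> C,
    analytic_on_disc f /\
    (forall nu : R, 0 < nu -> in_S (- nu) f) /\
    exists r : nat -> R,
      (forall k : nat, 0 < r k < 1) /\
      (forall k : nat, r k < r (S k)) /\
      is_lim_seq r (Finite 1) /\
      exists m : nat -> R,
        (forall k : nat, is_min (modulus_on_circle f (r k)) (m k)) /\
        is_lim_seq m p_infty.
Proof.
  set (a := fun n => RtoC (coeff n)).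
  assert (Ha : forall n, Cmod (a n) = coeff n).
  { intros n. unfold a. rewrite Cmod_R. apply Rabs_pos_eq, coeff_nonneg. }
  assert (Habs : forall r, 0 <= r < 1 -> ex_series (fun n => Cmod (a n) * r ^ n)).
  { intros r Hr. apply ex_series_ext with (fun n => coeff n * r ^ n).
    - intros n. now rewrite Ha.
    - now apply coeff_abs_conv. }
  destruct (ex_power_series a Habs) as [f Hf].
  pose proof (power_series_analytic a f Habs Hf) as Han.
  exists f. split; [exact Han|]. split.
  { intros nu Hnu. split; [exact Han|]. exists a. split; [exact Hf|].
    eapply ex_series_ext; [|exact (coeff_weighted_summable nu Hnu)].
    intros n. cbv beta. now rewrite Ha. }
  exists radius.
  split; [exact radius_bound|]. split; [exact radius_incr|]. split; [exact is_lim_radius|].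
  set (Hm := fun k => constructive_indefinite_description _
    (circle_min f (radius k) Han (radius_bound k))).
  exists (fun k => proj1_sig (Hm k)). split; [intros k; exact (proj2_sig (Hm k))|].
  apply is_lim_seq_le_p_loc with (fun k => / 6 * 10 ^ k).
  (* The minimum is attained at some [z] of the circle, so a lower bound for [Cmod (f z)]
     suffices. *)
  - exists O. intros k _. destruct (proj1 (proj2_sig (Hm k))) as (z & Hz & ->).
    pose proof (radius_bound k) as Hr.
    assert (Hterm : forall n,
      Cmod (scal (V := C_NormedModule) (pow_n (K := C_Ring) z n) (a n))
      = coeff n * radius k ^ n).
    { intros n. rewrite pow_n_C.
      change (Cmod (z ^ n * a n)%C = coeff n * radius k ^ n).
      rewrite Cmod_mult, Cmod_pow, Ha, Hz. ring. }
    pose proof (series_dominant_term _ _ (freq k) (term k k + 10 ^ k / 3)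
      (Hf z ltac:(lra))) as H.
    change (@norm C_AbsRing C_NormedModule) with Cmod in H. cbv beta in H.
    rewrite Hterm in H. unfold coeff at 1 in H.
    rewrite lacunary_at in H by exact freq_incr. fold (term k k) in H.
    pose proof (term_diag_ge k).
    (* The left side is [term k k - 10 ^ k / 3], at least [10 ^ k / 2 - 10 ^ k / 3 = 10 ^ k / 6]. *)
    assert (2 * term k k - (term k k + 10 ^ k / 3) <= Cmod (f z)); [|lra].
    apply H. intros M. erewrite sum_n_ext; [apply sum_coeff_le|]. exact Hterm.
  - replace p_infty with (Rbar_mult (/ 6) p_infty)
      by (apply is_Rbar_mult_unique, is_Rbar_mult_sym, is_Rbar_mult_p_infty_pos; simpl; lra).
    apply is_lim_seq_scal_l, is_lim_seq_geom_p. lra.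
Qed.
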